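(* Let $k\ge 2$. The word problem of $\mathsf{riAut}(k)$ over any finite generating set is in $\mathsf{P}$ (deterministic polynomial time).
   Context: Let $A$ be an alphabet with $|A|=k\ge 2$ and $A^*$ the free monoid. A right ideal is $R\subseteq A^*$ with $RA^*\subseteq R$; it is essential iff it intersects every (nonempty) right ideal. $\mathsf{riAut}(k)$ is the monoid (under composition of partial functions) of all bijections $\varphi:R_1\to R_2$ between finitely generated essential right ideals of $A^*$ with $\varphi(xw)=\varphi(x)w$ for $x\in R_1$, $w\in A^*$. The word problem of a monoid $M$ over a finite generating set $\Delta$ is: given two words $x,y\in\Delta^*$, decide whether $x$ and $y$ have the same value in $M$. *)

(* Defs.v *)
From HB Require Import structures.
From mathcomp Require Import all_boot all_algebra finmap.
From mathcomp Require Import boolp classical_sets.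

Set Implicit Arguments.
Unset Strict Implicit.
Unset Printing Implicit Defensive.

Local Open Scope classical_set_scope.

Section RightIdeals.
Variable A : finType.
Implicit Types R I : set (seq A).

Definition right_ideal R := forall x w, R x -> R (x ++ w).

Definition essential R := forall I, right_ideal I -> I !=set0 -> R `&` I !=set0.

Definition ideal_generated_by (F : seq (seq A)) : set (seq A) :=
  [set x | exists2 f, f \in F & exists w, x = f ++ w].

Definition finitely_generated R := exists F, R = ideal_generated_by F.

Definition fg_essential_right_ideal R :=
  [/\ right_ideal R, finitely_generated R & essential R].

(* A partial function on A^* is a total function into [option]; [None] means
   undefined. *)
Definition pdom (f : seq A -> option (seq A)) : set (seq A) :=
  [set x | exists y, f x = Some y].
Definition pim (f : seq A -> option (seq A)) : set (seq A) :=
  [set y | exists x, f x = Some y].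

Definition is_riAut (f : seq A -> option (seq A)) :=
  [/\ fg_essential_right_ideal (pdom f),
      fg_essential_right_ideal (pim f),
      forall x y z, f x = Some z -> f y = Some z -> x = y
    & forall x y w, f x = Some y -> f (x ++ w) = Some (y ++ w)].

End RightIdeals.

Record riAut (A : finType) := RiAut {
  riAut_fun :> seq A -> option (seq A);
  riAutP : is_riAut riAut_fun
}.

Section RiAutMonoid.
Variable A : finType.
Implicit Types f g h : riAut A.

HB.instance Definition _ := gen_eqMixin (riAut A).
HB.instance Definition _ := gen_choiceMixin (riAut A).

Lemma riAut_eq f g : f =1 g -> f = g.
Proof.
case: f g => [f fP] [g gP] /= /funext efg; move: gP; rewrite -efg => gP.
by congr RiAut; exact: Prop_irrelevance.
Qed.

Lemma all_fun_seq (P : seq A -> seq A -> Prop) (s : seq (seq A)) :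
  (forall c, c \in s -> exists d, P c d) ->
  exists t : seq (seq A),
    (forall c, c \in s -> exists2 d, d \in t & P c d) /\
    (forall d, d \in t -> exists2 c, c \in s & P c d).
Proof.
elim: s => [|c s IHs] Ps; first by exists [::].
have [|t [t1 t2]] := IHs; first by move=> e es; apply: Ps; rewrite inE es orbT.
have [d Pcd] := Ps c (mem_head _ _).
exists (d :: t); split=> [e|e]; rewrite inE => /predU1P[->|es].
- by exists d => //; exact: mem_head.
- by have [d' ? ?] := t1 e es; exists d' => //; rewrite inE; apply/orP; right.
- by exists c => //; exact: mem_head.
- by have [d' ? ?] := t2 e es; exists d' => //; rewrite inE; apply/orP; right.
Qed.

Lemma fg_setI (R S : set (seq A)) : right_ideal R -> right_ideal S ->
  finitely_generated R -> finitely_generated S -> finitely_generated (R `&` S).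
Proof.
move=> Rr Sr [F RE] [G SE].
exists ([seq c <- F | `[< S c >]] ++ [seq c <- G | `[< R c >]]).
have RF c : c \in F -> R c by move=> cF; rewrite RE; exists c => //; exists [::]; rewrite cats0.
have SG c : c \in G -> S c by move=> cG; rewrite SE; exists c => //; exists [::]; rewrite cats0.
apply/seteqP; split=> [x [Rx Sx]|x [c]].
  have [f fF [u xfu]] : ideal_generated_by F x by rewrite -RE.
  have [g gG [v xgv]] : ideal_generated_by G x by rewrite -SE.
  case: (leqP (size f) (size g)) => sfg.
    exists g; last by exists v.
    rewrite mem_cat !mem_filter gG andbT; apply/orP; right; apply/asboolP.
    have -> : g = f ++ take (size g - size f) u.
      have : take (size g) x = g by rewrite xgv take_size_cat.
      by rewrite xfu take_cat ltnNge sfg.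
    by apply: Rr; exact: RF.
  exists f; last by exists u.
  rewrite mem_cat !mem_filter fF andbT; apply/orP; left; apply/asboolP.
  have -> : f = g ++ take (size f - size g) v.
    have : take (size f) x = f by rewrite xfu take_size_cat.
    by rewrite xgv take_cat ltnNge (ltnW sfg).
  by apply: Sr; exact: SG.
rewrite mem_cat !mem_filter => /orP[/andP[/asboolP Sc cF]|/andP[/asboolP Rc cG]].
  by case=> w ->; split; [apply: Rr; exact: RF | exact: Sr].
by case=> w ->; split; [exact: Rr | apply: Sr; exact: SG].
Qed.

Lemma is_riAut_id : is_riAut (@Some (seq A)).
Proof.
have fgT : fg_essential_right_ideal [set: seq A].
  split=> //; last by move=> I _ [x Ix]; exists x.
  exists [:: [::]]; apply/seteqP; split=> // x _.
  by exists [::]; [rewrite mem_head | exists x].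
split.
- suff -> : pdom (@Some (seq A)) = setT by [].
  by apply/seteqP; split=> // x _; exists x.
- suff -> : pim (@Some (seq A)) = setT by [].
  by apply/seteqP; split=> // x _; exists x.
- by move=> x y z [->] [->].
- by move=> x y w [->].
Qed.

Lemma is_riAut_comp f g : is_riAut (fun x => obind f (g x)).
Proof.
have [[fdr fdf fde] [fir fif fie] fi fm] := riAutP f.
have [[gdr gdf gde] [gir gif gie] gi gm] := riAutP g.
have [C CE] := fg_setI gir fdr gif fdf.
have CP c : c \in C -> (pim g `&` pdom f) c.
  by move=> cC; rewrite CE; exists c => //; exists [::]; rewrite cats0.
have fgP x z : obind f (g x) = Some z <-> exists2 y, g x = Some y & f y = Some z.
  split; first by case gx: (g x) => [y|] //= fy; exists y.
  by case=> y -> .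
have CX x y z : g x = Some y -> f y = Some z ->
    exists2 c, c \in C & exists w, y = c ++ w.
  move=> gx fy; suff : (pim g `&` pdom f) y by rewrite CE.
  by split; [exists x | exists z].
have fgm x y w : obind f (g x) = Some y -> obind f (g (x ++ w)) = Some (y ++ w).
  by move=> /fgP[z gx fz]; apply/fgP; exists (z ++ w); [exact: gm | exact: fm].
split=> //.
- split.
  + by move=> x w [y /fgm fgx]; exists (y ++ w).
  + have [|D [D1 D2]] := @all_fun_seq (fun c d => g d = Some c) C.
      by move=> c /CP[[d gd] _]; exists d.
    exists D; apply/seteqP; split=> [x [z /fgP[y gx fy]]|x [d dD [w ->]]].
      have [c cC [w yE]] := CX _ _ _ gx fy; have [d dD gd] := D1 c cC.
      by exists d => //; exists w; apply: gi gx _; rewrite yE; exact: gm.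
    have [c /CP[_ [z fc]] gd] := D2 d dD.
    by exists (z ++ w); apply: fgm; apply/fgP; exists c.
  + move=> I Ir /(gde I Ir)[x [[y gx] Ix]].
    have [||z [[u fz] [w zE]]] := fde [set z | exists w, z = y ++ w].
    * by move=> z w [v ->]; exists (v ++ w); rewrite catA.
    * by exists y; exists [::]; rewrite cats0.
    * exists (x ++ w); split; last exact: Ir.
      by exists u; apply/fgP; exists z => //; rewrite zE; exact: gm.
- split.
  + by move=> y w [x /fgm fgx]; exists (x ++ w).
  + have [|D [D1 D2]] := @all_fun_seq (fun c d => f c = Some d) C.
      by move=> c /CP[_ [d fd]]; exists d.
    exists D; apply/seteqP; split=> [z [x /fgP[y gx fy]]|z [d dD [w ->]]].
      have [c cC [w yE]] := CX _ _ _ gx fy; have [d dD fc] := D1 c cC.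
      by exists d => //; exists w; move: fy; rewrite yE (fm _ _ _ fc) => -[].
    have [c /CP[[x gx] _] fc] := D2 d dD.
    by exists (x ++ w); apply: fgm; apply/fgP; exists c.
  + move=> I Ir /(fie I Ir)[z [[y fy] Iz]].
    have [||u [[x gx] [w uE]]] := gie [set u | exists w, u = y ++ w].
    * by move=> u w [v ->]; exists (v ++ w); rewrite catA.
    * by exists y; exists [::]; rewrite cats0.
    * exists (z ++ w); split; last exact: Ir.
      by exists x; apply/fgP; exists u => //; rewrite uE; exact: fm.
- move=> x y z /fgP[u gx fu] /fgP[v gy fv].
  by apply: gi gx _; rewrite (fi _ _ _ fu fv).
Qed.

Definition riAut_one : riAut A := RiAut is_riAut_id.
Definition riAut_mul f g : riAut A := RiAut (is_riAut_comp f g).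

Lemma riAut_mulA : associative riAut_mul.
Proof. by move=> f g h; apply: riAut_eq => x /=; case: (h x). Qed.

Lemma riAut_mul1 : left_id riAut_one riAut_mul.
Proof. by move=> f; apply: riAut_eq => x /=; case: (f x). Qed.

Lemma riAut_mulr1 : right_id riAut_one riAut_mul.
Proof. by move=> f; apply: riAut_eq. Qed.

HB.instance Definition _ :=
  isMonoid.Build (riAut A) riAut_mulA riAut_mul1 riAut_mulr1.

End RiAutMonoid.

Section WordProblem.
Variables (M : monoidType) (Delta : {fset M}).

Definition word_value (x : seq Delta) : M := (\prod_(d <- x) val d)%g.

Definition generating_set := forall m : M, exists x, word_value x = m.

(* The pair of words (x, y) is presented as the single word x#y, the
   separator # being [None]. *)
Definition word_problem : set (seq (option Delta)) :=
  [set w | exists x y, w = map Some x ++ None :: map Some y /\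
                       word_value x = word_value y].

End WordProblem.

Arguments word_problem {M} Delta _.

Section TuringMachines.
Variable S : finType.

Inductive move := MoveLeft | Stay | MoveRight.

(* A deterministic multitape machine with input alphabet S.  A tape cell holds
   [None] (blank), an input letter [Some (inl _)] or one of finitely many work
   symbols [Some (inr _)].  [tm_verdict q] is [None] unless q is halting, in
   which case it is [Some true] (accept) or [Some false] (reject). *)
Record turing_machine := TuringMachine {
  tm_work : finType;
  tm_tapes : nat;
  tm_state : finType;
  tm_start : tm_state;
  tm_verdict : tm_state -> option bool;
  tm_delta : tm_state -> {ffun 'I_tm_tapes.+1 -> option (S + tm_work)} ->
             tm_state * ('I_tm_tapes.+1 -> option (S + tm_work) * move)
}.

Variable M : turing_machine.

Definition cell : Type := option (S + tm_work M).

(* A two-way infinite tape: all cells outside the two lists are blank, and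
   [tape_left] lists the cells to the left of the head starting with the
   nearest one. *)
Record tape := Tape {
  tape_left : seq cell;
  tape_head : cell;
  tape_right : seq cell
}.

Definition tape_of (s : seq cell) : tape :=
  Tape [::] (head None s) (behead s).

Definition tape_update (t : tape) (a : cell * move) : tape :=
  let: Tape l _ r := t in
  match a.2 with
  | MoveLeft => Tape (behead l) (head None l) (a.1 :: r)
  | Stay => Tape l a.1 r
  | MoveRight => Tape (a.1 :: l) (head None r) (behead r)
  end.

Definition config : Type := tm_state M * ('I_(tm_tapes M).+1 -> tape).

Definition tm_init (w : seq S) : config :=
  (tm_start M,
   fun i => if i == ord0 then tape_of [seq Some (inl a) | a <- w]
            else tape_of [::]).

Definition tm_step (c : config) : config :=
  if tm_verdict c.1 is Some _ then c else
  let: (q, act) := tm_delta c.1 [ffun i => tape_head (c.2 i)] in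
  (q, fun i => tape_update (c.2 i) (act i)).

Definition tm_answers_within (t : nat) (w : seq S) (b : bool) :=
  tm_verdict (iter t tm_step (tm_init w)).1 = Some b.

End TuringMachines.

Definition in_P (S : finType) (L : set (seq S)) :=
  exists (M : turing_machine S) (p : {poly nat}), forall w : seq S,
    exists2 b : bool, tm_answers_within M (p.[size w])%R w b & (b <-> L w).

(* Main.v *)
Require Import Defs.
From HB Require Import structures.
From mathcomp Require Import all_boot all_algebra finmap.
From mathcomp Require Import boolp zify.

Set Implicit Arguments.
Unset Strict Implicit.
Unset Printing Implicit Defensive.

(** To compare the values f and g of two words, search A^* depth first from the
   empty word.  At v compute f(v) and g(v), applying the generators one at a
   time: a generator rewrites a prefix of bounded length of its argument.
   Reject if f(v) and g(v) differ; if both are undefined continue with the words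
   va; if they agree and are defined, then f and g agree on v A^* and the search
   backtracks.  The search is polynomial: the complement of the domain of f is
   finite, because that domain is finitely generated and essential, and its
   cardinal is subadditive under composition by injectivity. *)

(** * Halted Turing machines *)

Lemma tm_step_halted (S : finType) (M : turing_machine S) c b n :
  @tm_verdict S M c.1 = Some b -> iter n (@tm_step S M) c = c.
Proof. by move=> vc; elim: n => //= n ->; rewrite /tm_step vc. Qed.

Lemma tm_answers_within_mono (S : finType) (M : turing_machine S) t t' w b :
  t <= t' -> tm_answers_within M t w b -> tm_answers_within M t' w b.
Proof.
move=> /subnK <-; rewrite /tm_answers_within iterD => vt.
by rewrite (tm_step_halted _ vt).
Qed.

(** * Simulation of multistack machines by multitape Turing machines *)

Section StackMachine.
Variables (S W : finType) (m L K : nat) (Q : finType).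
Let G : Type := (S + W)%type.
Variables (q0 : Q) (verdict : Q -> option bool).
Variable prog : Q -> ('I_m.+1 -> seq G) -> Q * ('I_m.+1 -> seq G).
Hypothesis leLK : L <= K.
Hypothesis prog_size : forall q v i,
  (forall j, size (v j) <= L) -> size ((prog q v).2 i) <= K.

(* One step sees the top [L] letters of every stack (fewer only when the stack
   is shorter) and replaces them. *)
Definition sm_step (c : Q * ('I_m.+1 -> seq G)) :=
  if verdict c.1 is Some _ then c else
  let r := prog c.1 (fun i => take L (c.2 i)) in
  (r.1, fun i => r.2 i ++ drop L (c.2 i)).

Definition sm_init (w : seq S) : Q * ('I_m.+1 -> seq G) :=
  (q0, fun i => if i == ord0 then rev (map inl w) else [::]).

(* [None] moves the input head to the last letter, turning tape 0 into a stack.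
   In [Some (q, (b, j), buf)], the buffers collect the popped letters when [b]
   is false, and hold the reversals of the words still to be pushed when [b] is
   true; [j] counts the steps of the current phase. *)
Definition sm_state : finType :=
  option (Q * (bool * 'I_K.+1) * {ffun 'I_m.+1 -> K.-bseq G}).

Definition sm_delta (st : sm_state) (h : {ffun 'I_m.+1 -> option G}) :
    sm_state * ('I_m.+1 -> option G * move) :=
  match st with
  | None =>
    if h ord0 is Some _ then
      (None, fun i => (h i, if i == ord0 then MoveRight else Stay))
    else (Some (q0, (false, ord0), [ffun=> [bseq]]),
          fun i => (h i, if i == ord0 then MoveLeft else Stay))
  | Some (q, (false, j), buf) =>
    if j < L then
      (Some (q, (false, inord j.+1),
             [ffun i => insub_bseq K (buf i ++ seq_of_opt (h i))]),
       fun i => (h i, if h i is Some _ then MoveLeft else Stay))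
    else
      let r := prog q (fun i => buf i) in
      (Some (r.1, (true, ord0), [ffun i => insub_bseq K (rev (r.2 i))]),
       fun i => (h i, MoveRight))
  | Some (q, (true, j), buf) =>
    if j < K then
      (Some (q, (true, inord j.+1),
             [ffun i => insub_bseq K (behead (buf i))]),
       fun i => if ohead (buf i) is Some a then (Some a, MoveRight)
                else (h i, Stay))
    else (Some (q, (false, ord0), [ffun=> [bseq]]), fun i => (h i, MoveLeft))
  end.

(** A verdict is reported only between two simulated steps, when every stack is back on its tape. *)
Definition sm_verdict (st : sm_state) : option bool :=
  if st is Some (q, (b, j), _) then
    if ~~ b && (j == ord0) then verdict q else None
  else None.

Definition sm_tm : turing_machine S :=
  TuringMachine (None : sm_state) sm_verdict sm_delta.

Let T := tape sm_tm.
(** The head stands on the top letter while popping and just above it while pushing. Popped letters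
    are not erased, so cells to the right are ignored, and so is the cell under the head while
    pushing. Comparing entrywise makes padding blanks harmless. *)
Definition popping (t : T) (s : seq G) :=
  nth None (tape_head t :: tape_left t) =1 onth s.
Definition pushing (t : T) (s : seq G) := nth None (tape_left t) =1 onth s.

Lemma popping_head t s : popping t s -> tape_head t = ohead s.
Proof. by move=> /(_ 0) /=; case: s. Qed.

Lemma popping_left t x s :
  pushing t s -> popping (tape_update t (x, MoveLeft)) s.
Proof. by case: t => -[|a l] h r ts [|i]; rewrite -ts //= nth_nil. Qed.

Lemma popping_pop t x a s :
  popping t (a :: s) -> popping (tape_update t (x, MoveLeft)) s.
Proof.
by move=> ts; apply: popping_left => i; rewrite -[RHS]/(onth (a :: s) i.+1) -ts.
Qed.

Lemma pushing_right t s :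
  popping t s -> pushing (tape_update t (tape_head t, MoveRight)) s.
Proof. by case: t. Qed.

Lemma pushing_push t a s :
  pushing t s -> pushing (tape_update t (Some a, MoveRight)) (a :: s).
Proof. by case: t => l h r ts [|i] //=; exact: ts. Qed.

Lemma tape_update_stay (t : T) : tape_update t (tape_head t, Stay) = t.
Proof. by case: t. Qed.

Lemma insub_bseqK (s : seq G) : size s <= K -> insub_bseq K s = s :> seq G.
Proof. by move=> sK; rewrite /insub_bseq val_insubd sK. Qed.

Definition simulates (c : config sm_tm) (d : Q * ('I_m.+1 -> seq G)) :=
  c.1 = Some (d.1, (false, ord0), [ffun=> [bseq]]) /\
  forall i, popping (c.2 i) (d.2 i).

(** Invariant of the popping phase: buffer and tape together always hold the whole stack. *)
Lemma sm_read (c : config sm_tm) d j : verdict d.1 = None -> simulates c d ->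
  j <= L ->
  exists buf, (iter j (@tm_step S sm_tm) c).1
    = Some (d.1, (false, inord j), buf) /\
  forall i, buf i = take j (d.2 i) :> seq G /\
    popping ((iter j (@tm_step S sm_tm) c).2 i) (drop j (d.2 i)).
Proof.
move=> vd [c1 c2]; elim: j => [_|j IHj ltjL].
  exists [ffun=> [bseq]]; split=> [|i]; last by rewrite ffunE take0 drop0.
  by rewrite c1; congr (Some (_, (_, _), _)); apply: val_inj; rewrite /= inordK.
have [buf [e1 e2]] := IHj (ltnW ltjL).
rewrite iterS; move: e1 e2; case: (iter j _ c) => q t /= -> e2.
have ltjK : j < K.+1 by lia.
rewrite /tm_step /= inordK // ltjL.
(* For [j = 0] the machine would be halted if [d.1] were a halting state. *)
have -> : (if (inord j : 'I_K.+1) == ord0 then verdict d.1 else None) = None.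
  by rewrite vd if_same.
eexists; split; first by [].
move=> i; have [bi ti] := e2 i.
rewrite /= !ffunE bi; have th := popping_head ti.
case ds : (drop j (d.2 i)) => [|a s]; rewrite ds in th; rewrite th /= ?cats0.
  (* The stack is exhausted: the head rests on a blank and the buffer stops growing. *)
  have sj : size (d.2 i) <= j by rewrite -subn_eq0 -size_drop ds.
  rewrite insub_bseqK; last by rewrite size_take_min; lia.
  rewrite !take_oversize ?drop_oversize //; try lia.
  by rewrite -[X in (X, Stay)]th tape_update_stay; split=> //; rewrite -ds.
have ltj : j < size (d.2 i).
  by rewrite ltnNge -subn_eq0 -size_drop ds.
have e : take j (d.2 i) ++ [:: a] = take j.+1 (d.2 i).
  rewrite (take_nth a) // cats1; congr rcons.
  by rewrite -(addn0 j) -nth_drop ds.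
rewrite e insub_bseqK; last by rewrite size_take_min; lia.
split=> //.
have -> : drop j.+1 (d.2 i) = s by rewrite -addn1 addnC -drop_drop ds /= drop0.
by rewrite ds in ti; exact: popping_pop ti.
Qed.

Lemma sm_write (c : config sm_tm) q buf (s : 'I_m.+1 -> seq G) j :
  c.1 = Some (q, (true, ord0), buf) -> (forall i, pushing (c.2 i) (s i)) ->
  j <= K ->
  exists buf', (iter j (@tm_step S sm_tm) c).1
    = Some (q, (true, inord j), buf') /\
  forall i, buf' i = drop j (buf i) :> seq G /\
    pushing ((iter j (@tm_step S sm_tm) c).2 i) (rev (take j (buf i)) ++ s i).
Proof.
move=> c1 c2; elim: j => [_|j IHj ltjK].
  exists buf; split=> [|i]; last by rewrite take0 drop0; split=> //; exact: c2.
  by rewrite c1; congr (Some (_, (_, _), _)); apply: val_inj; rewrite /= inordK.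
have [buf' [e1 e2]] := IHj (ltnW ltjK).
rewrite iterS; move: e1 e2; case: (iter j _ c) => q' t /= -> e2.
rewrite /tm_step /= inordK ?(leqW ltjK) // ltjK.
eexists; split; first by [].
move=> i; have [bi ti] := e2 i.
rewrite /= !ffunE bi insub_bseqK; last first.
  by rewrite -drop1 !size_drop -subnDA (leq_trans (leq_subr _ _)) ?size_bseq.
rewrite -drop1 drop_drop add1n; split=> //.
case ds : (drop j (buf i)) => [|a r] /=.
  have sj : size (buf i) <= j by rewrite -subn_eq0 -size_drop ds.
  by rewrite tape_update_stay; rewrite !take_oversize // in ti *; exact: leqW.
have ltj : j < size (buf i).
  by rewrite ltnNge -subn_eq0 -size_drop ds.
rewrite (take_nth a) // rev_rcons.
have -> : nth a (buf i) j = a by rewrite -(addn0 j) -nth_drop ds.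
exact: pushing_push.
Qed.

(** One round consists of [L] pops, one application of [prog], [K] pushes and one step back onto the
    top letters. *)
Lemma sm_simulation_step c d : simulates c d -> verdict d.1 = None ->
  simulates (iter (L + K + 2) (@tm_step S sm_tm) c) (sm_step d).
Proof.
move=> cd vd.
have [buf [b1 b2]] := sm_read vd cd (leqnn L).
have -> : L + K + 2 = 1 + (K + (1 + L)) by lia.
rewrite !iterD; move: b1 b2; set cL := iter L _ c.
case: cL => q t /= -> b2.
set c1 := tm_step (_, t).
have [c11 c12] : c1.1 = Some ((sm_step d).1, (true, ord0),
    [ffun i => insub_bseq K (rev ((prog d.1 (fun i => take L (d.2 i))).2 i))])
  /\ forall i, pushing (c1.2 i) (drop L (d.2 i)).
  rewrite /c1 /tm_step /= inordK // ltnn /sm_step vd if_same.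
  have -> : (fun i => buf i : seq G) = (fun i => take L (d.2 i)).
    by apply/funext => i; have [] := b2 i.
  split=> // i /=; rewrite ffunE; apply: pushing_right.
  by have [] := b2 i.
have [buf' [e1 e2]] := sm_write c11 c12 (leqnn K).
move: e1 e2; case: (iter K _ c1) => q' t' /= -> e2.
rewrite /tm_step /= inordK // ltnn; split=> // i /=.
apply: popping_left; have [_] := e2 i.
rewrite ffunE insub_bseqK; last first.
  by rewrite size_rev prog_size // => l; rewrite size_take_min; lia.
(* The buffer holds the reversed replacement, and pushing it letter by letter reverses it again; [K]
   pushes empty it. *)
rewrite take_oversize ?revK; first by rewrite /sm_step vd.
by rewrite size_rev prog_size // => l; rewrite size_take_min; lia.
Qed.

Lemma sm_simulation t c d b : simulates c d ->
  verdict (iter t sm_step d).1 = Some b ->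
  sm_verdict (iter (t * (L + K + 2)) (@tm_step S sm_tm) c).1 = Some b.
Proof.
elim: t c d => [|t IHt] c d cd; first by case: cd => /= ->.
rewrite iterSr mulSn addnC iterD.
case vd : (verdict d.1) => [b'|]; last by apply: IHt; exact: sm_simulation_step.
have -> : sm_step d = d by rewrite /sm_step vd.
move=> vt; have {}vt : Some b' = Some b.
  rewrite -vt; suff -> : iter t sm_step d = d by rewrite vd.
  by elim: t {IHt vt} => //= t ->; rewrite /sm_step vd.
have vc : @tm_verdict S sm_tm c.1 = Some b by case: cd => -> _ /=; rewrite vd.
by rewrite !(tm_step_halted _ vc).
Qed.

(** Induction on the unread part [w'], the letters of [w] being to the left of the head. The extra
    step goes back from the first blank. *)
Lemma sm_load (w w' : seq S) (c : config sm_tm) :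
  c.1 = None -> (forall i, i != ord0 -> popping (c.2 i) [::]) ->
  pushing (c.2 ord0) (rev (map inl w)) ->
  tape_head (c.2 ord0) = omap inl (ohead w') ->
  tape_right (c.2 ord0) = behead [seq Some (inl a) | a <- w'] ->
  simulates (iter (size w').+1 (@tm_step S sm_tm) c) (sm_init (w ++ w')).
Proof.
elim: w' w c => [|a w' IHw] w [q t] /= -> t0 tl th tr.
  rewrite /tm_step /= ffunE th /= cats0; split=> // i.
  rewrite /= ?ffunE; case: eqP => [->|/eqP i0]; first exact: popping_left.
  by rewrite tape_update_stay; exact: t0.
rewrite -iterS iterSr -cat_rcons; set c' := tm_step (_, t).
have -> : c' = (None, fun i => tape_update (t i)
    (tape_head (t i), if i == ord0 then MoveRight else Stay)).
  rewrite /c' /tm_step /= ffunE th /=; congr pair.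
  by apply/funext => i; rewrite ffunE.
apply: IHw => //=.
- by move=> i i0; rewrite (negPf i0) tape_update_stay; exact: t0.
- by rewrite map_rcons rev_rcons th; exact: pushing_push.
- by case: (t ord0) tr => l h r /= ->; case: (w').
- by case: (t ord0) tr => l h r /= ->.
Qed.

Theorem sm_tm_answers t w b :
  verdict (iter t sm_step (sm_init w)).1 = Some b ->
  tm_answers_within sm_tm ((size w).+1 + t * (L + K + 2)) w b.
Proof.
rewrite /tm_answers_within addnC iterD; apply: sm_simulation.
apply: (@sm_load [::]) => //=.
- by move=> i /negPf -> [|i'] //=; rewrite nth_nil.
- by case=> [|i].
- by case: w.
Qed.

End StackMachine.

(** * Domains and values of products of generators *)

Section RiAutWords.
Variables (A : finType) (Delta : {fset riAut A}).
Implicit Types (f g : riAut A) (v : seq A) (x y : seq Delta).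

Lemma riAut_cat f v u r : f v = Some r -> f (v ++ u) = Some (r ++ u).
Proof. by case: (riAutP f) => _ _ _; apply. Qed.

(** By essentiality the right ideal generated by [v] meets the domain, in an extension of some
    generator [c] of that ideal. If [v] is at least as long as [c], then [c] is a prefix of [v]. *)
Lemma riAut_long_defined f : exists l, forall v, l <= size v -> isSome (f v).
Proof.
have [[dr [F FE] de] _ _ _] := riAutP f.
exists (\max_(c <- F) size c) => v lv.
have [||z [dz [w zE]]] := de (fun z => exists w, z = v ++ w).
- by move=> z w [u ->]; exists (u ++ w); rewrite catA.
- by exists v; exists [::]; rewrite cats0.
have [c cF [u zcu]] : ideal_generated_by F z by rewrite -FE.
suff : pdom f v by case=> r ->.
rewrite FE; exists c => //; exists (drop (size c) v).
have cv : size c <= size v by apply: leq_trans lv; exact: leq_bigmax_seq.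
have : take (size c) z = c by rewrite zcu take_size_cat.
by rewrite zE takel_cat // => {1}<-; rewrite cat_take_drop.
Qed.

Lemma generators_long_defined :
  exists l, forall (d : Delta) v, l <= size v -> isSome (val d v).
Proof.
have [l_ l_P] := choice (fun d : Delta => riAut_long_defined (val d)).
exists (\max_d l_ d) => d v lv; apply: l_P.
by apply: leq_trans lv; exact: leq_bigmax.
Qed.

Lemma word_value_nil v : word_value ([::] : seq Delta) v = Some v.
Proof. by rewrite /word_value big_nil. Qed.

Lemma word_value_cons (d : Delta) x v :
  word_value (d :: x) v = obind (val d) (word_value x v).
Proof. by rewrite /word_value big_cons. Qed.

(** Allowing an undefined start lets evaluation be resumed in the middle of a word. *)
Definition eval_from (z : option (seq A)) x :=
  foldr (fun (d : Delta) => obind (val d)) z x.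

Lemma eval_fromE x v : eval_from (Some v) x = word_value x v.
Proof.
by elim: x => [|d x IHx] /=; rewrite ?word_value_nil // word_value_cons IHx.
Qed.

Variable l : nat.
Hypothesis lP : forall (d : Delta) v, l <= size v -> isSome (val d v).

(** A generator is local: a prefix of length [l] already lies in its domain, and the rest is carried
    along. A bounded window on a stack therefore suffices to apply it. *)
Lemma generator_take (d : Delta) v :
  val d v = omap (cat^~ (drop l v)) (val d (take l v)).
Proof.
case: (leqP l (size v)) => [lv|/ltnW vl]; last first.
  rewrite take_oversize // drop_oversize //.
  by case: (val d v) => //= r; rewrite cats0.
have : isSome (val d (take l v)) by apply: lP; rewrite size_takel.
case dv : (val d (take l v)) => [r|] // _ /=.
by rewrite -(riAut_cat _ dv) cat_take_drop.
Qed.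

(** Each generator shortens its argument by at most [l] letters. *)
Lemma word_value_long x v : l * size x <= size v -> isSome (word_value x v).
Proof.
(* The induction needs a reserve of [m] letters that survives the evaluation. *)
suff H m : l * size x + m <= size v ->
    exists2 r, word_value x v = Some r & m <= size r.
  by move=> lv; have [|r ->] := H 0; rewrite ?addn0.
elim: x m => [|d x IHx] m /=.
  by rewrite muln0 add0n => mv; exists v; rewrite ?word_value_nil.
rewrite mulnS => lv; have [|r xv lr] := IHx (l + m); first by lia.
rewrite word_value_cons xv /= generator_take.
have : isSome (val d (take l r)) by apply: lP; rewrite size_takel //; lia.
case: (val d _) => // r' _ /=; exists (r' ++ drop l r) => //.
by rewrite size_cat size_drop; lia.
Qed.

(* The complement of the domain of [f \o g] is that of [g] together with the
   preimage by the injection [g] of that of [f]. *)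
Lemma undefined_comp f g (s t : seq (seq A)) :
  (forall v, f v = None -> v \in s) -> (forall v, g v = None -> v \in t) ->
  exists2 r, size r <= size s + size t &
    forall v, obind f (g v) = None -> v \in r.
Proof.
move=> fs gt; have [_ _ gi _] := riAutP g.
suff [r sr rP] : exists2 r, size r <= size s &
    forall v z, g v = Some z -> z \in s -> v \in r.
  exists (r ++ t) => [|v]; first by rewrite size_cat leq_add2r.
  case gv : (g v) => [z|] /= fz; rewrite mem_cat ?(gt _ gv) ?orbT //.
  by rewrite (rP v z gv) // fs.
elim: s {fs} => [|z s [r sr rP]]; first by exists [::].
have [[u gu]|ng] := pselect (exists u, g u = Some z).
  exists (u :: r) => // v z' gv; rewrite !inE => /orP[/eqP zz|zs].
    by rewrite (gi v u z) ?eqxx // -zz.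
  by rewrite (rP v z') ?orbT.
exists r => [|v z' gv]; first exact: leqW.
rewrite inE => /orP[/eqP zz|]; last exact: rP gv.
by case: ng; exists v; rewrite -zz.
Qed.

(** A generator is undefined only at words of the finite list [s1]; by [undefined_comp] each letter
    of [x] adds at most [size s1] undefined words. *)
Lemma undefined_words : exists C, forall x, exists2 s, size s <= C * size x &
  forall v, word_value x v = None -> v \in s.
Proof.
pose s1 := [seq val u | u : l.-bseq A].
have s1P (d : Delta) v : val d v = None -> v \in s1.
  move=> dv; have vl : size v <= l.
    by rewrite leqNgt; apply/negP => /ltnW /(lP d); rewrite dv.
  by apply/mapP; exists (Bseq vl); rewrite ?mem_enum.
exists (size s1); elim=> [|d x [s ss sP]].
  by exists [::] => // v; rewrite word_value_nil.
have [r rs rP] := undefined_comp (s1P d) sP.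
exists r => [|v]; last by rewrite word_value_cons; exact: rP.
by rewrite /= mulnS; apply: leq_trans rs _; rewrite leq_add2l.
Qed.

Lemma generator_take_size_bound : exists B, forall (d : Delta) v r,
  size v <= l -> val d v = Some r -> size r <= B.
Proof.
exists (\max_(d : Delta) \max_(u : l.-bseq A)
  size (odflt [::] ((val d : riAut A) u))) => d v r vl dv.
apply: (leq_trans _ (leq_bigmax d)).
apply: (leq_trans _ (leq_bigmax (Bseq vl))).
by rewrite /= dv.
Qed.

End RiAutWords.

(** * Counting the words below a node of the tree of words *)

Section PrefixCount.
Variable A : finType.

(** An extension of [v] is either [v] itself or lies below exactly one child of [v]. *)
Lemma count_prefix_children (v : seq A) (s : seq (seq A)) :
  count_mem v s + \sum_(a : A) count (prefix (rcons v a)) s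
    <= count (prefix v) s.
Proof.
elim: s => [|u s IHs] /=; first by rewrite big1.
rewrite big_split /= addnACA leq_add //.
case: (boolP (prefix v u)) => [/prefixP[[|b u'] ->]|vu].
- rewrite cats0 eqxx big1 // => a _.
  by case: prefixP => // -[t /(congr1 size)]; rewrite size_cat size_rcons; lia.
- have -> : (v ++ b :: u' == v) = false.
    by apply/eqP => /(congr1 size); rewrite size_cat /=; lia.
  rewrite (bigD1 b) //= big1 => [|a ab]; first by rewrite add0n addn0 leq_b1.
  case: prefixP => // -[t]; rewrite cat_rcons => /eqP.
  by rewrite eqseq_cat // eqxx /= eqseq_cons eq_sym (negPf ab).
- have -> : (u == v) = false.
    by apply: contraNF vu => /eqP ->; exact: prefix_refl.
  rewrite big1 // => a _; case: prefixP => // -[t uE].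
  by move: vu; rewrite uE cat_rcons prefix_prefix.
Qed.

End PrefixCount.

(** * The stack program deciding the word problem *)

Inductive phase :=
  Copy | Eval of bool & bool & bool | Rewind of bool | Next | Halt of bool.

Definition phase_code (q : phase) : bool * bool * bool + bool + bool + bool :=
  match q with
  | Copy => inr true
  | Next => inr false
  | Halt b => inl (inr b)
  | Rewind u => inl (inl (inr u))
  | Eval b u o => inl (inl (inl (b, u, o)))
  end.

Definition phase_decode c :=
  match c with
  | inr b => if b then Copy else Next
  | inl (inr b) => Halt b
  | inl (inl (inr u)) => Rewind u
  | inl (inl (inl (b, u, o))) => Eval b u o
  end.

Lemma phase_codeK : cancel phase_code phase_decode.
Proof. by case. Qed.

HB.instance Definition _ := Finite.copy phase (can_type phase_codeK).

Section Program.
Variables (A : finType) (Delta : {fset riAut A}) (a0 : A) (l B : nat).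
Hypothesis a0P : onth (enum A) 0 = Some a0.
Hypothesis lP : forall (d : Delta) v, l.+1 <= size v -> isSome (val d v).
Hypothesis BP : forall (d : Delta) v r,
  size v <= l.+1 -> val d v = Some r -> size r <= B.

Let S : finType := option Delta.
Let G : Type := (S + A)%type.
Let letter (a : A) : G := inr a.
Let sym (d : Delta) : G := inl (Some d).
Let hash : G := inl None.

Definition next_letter (a : A) := onth (enum A) (index a (enum A)).+1.

(** The flag [u] is absorbing: once the value is undefined, the stack is left as it is. *)
Definition act (d : Delta) (u : bool) (s : seq G) : bool * seq G :=
  if u then (u, s) else
  if val d (pmap (fun g : G => if g is inr a then Some a else None) s) is Some r
  then (false, map letter r) else (true, s).

(* Stacks I and J hold the input left and right of the head, V and W the
   current word of A^*, X and Y the values there of the two input words (junk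
   when undefined).  In [Eval b u o], [b] tells whether the first word is being
   applied (to X) or the second (to Y); [u] and [o] tell whether the value of
   that word, resp. the other one, is undefined. *)
Definition prog6 (q : phase) (I J V W X Y : seq G) : phase * seq (seq G) :=
  match q with
  | Copy =>
    if V is a :: V' then (Copy, [:: I; J; V'; a :: W; a :: X; a :: Y])
    else (Eval false false false, [:: I; J; V; W; X; Y])
  | Eval b u o =>
    match I with
    | inl (Some d) :: I' =>
      let z := act d u (if b then X else Y) in
      (Eval b z.1 o, [:: I'; sym d :: J; V; W;
                         if b then z.2 else X; if b then Y else z.2])
    | inl None :: I' =>
      (if b then Halt false else Eval true o u,
       [:: I'; hash :: J; V; W; X; Y])
    | _ => (if b && (u == o) then Rewind u else Halt false,
            [:: I; J; V; W; X; Y])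
    end
  | Rewind u =>
    if [&& nilp J, nilp W, nilp X & nilp Y] then
      (if u then Copy else Next,
       [:: I; J; if u then letter a0 :: V else V; W; X; Y])
    else if ~~ u && (ohead X != ohead Y) then
      (Halt false, [:: I; J; V; W; X; Y])
    else (Rewind u, [:: take 1 J ++ I; behead J; take 1 W ++ V; behead W;
                        behead X; behead Y])
  | Next =>
    match V with
    | inr a :: V' =>
      if next_letter a is Some a'
      then (Copy, [:: I; J; letter a' :: V'; W; X; Y])
      else (Next, [:: I; J; V'; W; X; Y])
    | _ => (Halt true, [:: I; J; V; W; X; Y])
    end
  | Halt _ => (q, [:: I; J; V; W; X; Y])
  end.

Definition stacks (ss : seq (seq G)) : 'I_6 -> seq G := fun i => nth [::] ss i.

Definition prog (q : phase) (v : 'I_6 -> seq G) : phase * ('I_6 -> seq G) :=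
  let s k := v (inord k) in
  let r := prog6 q (s 0) (s 1) (s 2) (s 3) (s 4) (s 5) in (r.1, stacks r.2).

Definition phase_verdict (q : phase) := if q is Halt b then Some b else None.

Let step := sm_step l.+1 phase_verdict prog.

Lemma step6 q I J V W X Y : phase_verdict q = None ->
  step (q, stacks [:: I; J; V; W; X; Y]) =
    let t s := take l.+1 s in let d s := drop l.+1 s in
    let r := prog6 q (t I) (t J) (t V) (t W) (t X) (t Y) in
    let o := nth [::] r.2 in
    (r.1, stacks [:: o 0 ++ d I; o 1 ++ d J; o 2 ++ d V; o 3 ++ d W;
                     o 4 ++ d X; o 5 ++ d Y]).
Proof.
move=> vq; rewrite /step /sm_step vq /prog /stacks /= !inordK //.
by congr pair; apply/funext => -[[|[|[|[|[|[|]]]]]] lti].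
Qed.

Lemma act_size d u s : size s <= l.+1 -> size (act d u s).2 <= maxn l.+1 B.
Proof.
rewrite /act => sl; case: u => /=; first by rewrite leq_max sl.
case E: (val d _) => [r|] /=; last by rewrite leq_max sl.
rewrite size_map leq_max (BP _ E) ?orbT //; apply: leq_trans sl.
by rewrite size_pmap count_size.
Qed.

Lemma prog_size q v i :
  (forall j, size (v j) <= l.+1) -> size ((prog q v).2 i) <= l.+2 + B.
Proof.
move=> vl; rewrite /prog /=.
have := (vl (inord 0), vl (inord 1), vl (inord 2), vl (inord 3), vl (inord 4),
  vl (inord 5)).
move: (v (inord 0)) (v (inord 1)) (v (inord 2)) (v (inord 3)) (v (inord 4))
  (v (inord 5)) => I J V W X Y.
move=> [[[[[sI sJ] sV] sW] sX] sY].
suff : all (fun s => size s <= l.+2 + B) (prog6 q I J V W X Y).2.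
  rewrite /stacks; set ss := (prog6 _ _ _ _ _ _ _).2 => ssP.
  case: (ltnP i (size ss)) => ti; last by rewrite nth_default.
  by apply: (allP ssP); rewrite mem_nth.
have szZ d b u : size (act d u (if b then X else Y)).2 <= maxn l.+1 B.
  by apply: act_size; case: b.
have le s : size s <= l.+1 -> size s <= l.+2 + B by lia.
case: q => [|b u o|u||b] /=.
- by case: V sV => [|a V'] /= sV; repeat (apply/andP; split); lia.
- case: I sI => [|[[d|]|a] I'] /= sI; try by repeat (apply/andP; split); lia.
  by have := szZ d b u; case: b => /= ?; repeat (apply/andP; split); lia.
- case: ifP => _ /=; first by case: u; repeat (apply/andP; split) => /=; lia.
  case: ifP => _ /=; first by repeat (apply/andP; split); lia.
  rewrite !size_cat !size_behead !size_take_min.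
  by repeat (apply/andP; split); lia.
- case: V sV => [|[d|a] V'] /= sV; try by repeat (apply/andP; split); lia.
  by case: (next_letter a) => [a'|] /=; repeat (apply/andP; split); lia.
- by repeat (apply/andP; split); lia.
Qed.

(** * Runs of the single phases *)

Lemma copy_run I J V W X Y :
  iter (size V).+1 step (Copy, stacks [:: I; J; V; W; X; Y])
    = (Eval false false false,
       stacks [:: I; J; [::]; catrev V W; catrev V X; catrev V Y]).
Proof.
elim: V W X Y => [|a V IHV] W X Y; rewrite iterSr.
  by rewrite step6 // /= !cat_take_drop.
by rewrite step6 // /= !cat_take_drop -iterS IHV.
Qed.

Definition value (u : bool) (Z : seq A) := if u then None else Some Z.

(** By [generator_take], acting on the window amounts to acting on the whole word. *)
Lemma act_full d u Z : exists Z',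
  let z := act d u (take l.+1 (map letter Z)) in
  [/\ z.2 ++ drop l.+1 (map letter Z) = map letter Z',
      value z.1 Z' = obind (val d) (value u Z) & size Z' <= size Z + B].
Proof.
rewrite /act; case: u => /=.
  by exists Z; rewrite cat_take_drop leq_addr.
have -> : pmap (fun g : G => if g is inr a then Some a else None)
    (take l.+1 (map letter Z)) = take l.+1 Z.
  by rewrite -map_take; elim: (take _ _) => //= a s ->.
rewrite (generator_take lP d Z) -map_drop.
case dZ: (val d (take l.+1 Z)) => [r|] /=; last first.
  by exists Z; rewrite -map_take -map_cat cat_take_drop leq_addr.
exists (r ++ drop l.+1 Z); rewrite map_cat; split=> //.
have := BP _ dZ; rewrite size_cat size_drop size_take_min; lia.
Qed.

(** [Z] is the word being rewritten and [O] the other one, so that one lemma serves both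
    evaluations. *)
Definition estacks b I J V W Z O :=
  stacks [:: I; J; V; W; if b then map letter Z else map letter O;
             if b then map letter O else map letter Z].

Lemma eval_run y b u o I J V W Z O : exists u' Z',
  [/\ iter (size y) step
        (Eval b u o, estacks b (map sym (rev y) ++ I) J V W Z O)
      = (Eval b u' o, estacks b I (map sym y ++ J) V W Z' O),
      value u' Z' = eval_from (value u Z) y
    & size Z' <= size Z + B * size y].
Proof.
elim/last_ind: y u J Z => [|y d IHy] u J Z.
  by exists u, Z; rewrite muln0 addn0.
have [Z1 [Z1E vZ1 sZ1]] := act_full d u Z.
have [u' [Z' [IH vZ' sZ']]] :=
  IHy (act d u (take l.+1 (map letter Z))).1 (sym d :: J) Z1.
exists u', Z'; split; last by rewrite size_rcons mulnS; lia.
  rewrite size_rcons iterSr rev_rcons /estacks /=.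
  rewrite step6 // /= !cat_take_drop.
  rewrite map_rcons cat_rcons -IH /estacks -Z1E.
  by case: (b); rewrite /= ?cat_take_drop.
by rewrite vZ' vZ1 /eval_from foldr_rcons.
Qed.

Lemma eval_hash b u o I J V W X Y :
  step (Eval b u o, stacks [:: hash :: I; J; V; W; X; Y])
    = (if b then Halt false else Eval true o u,
       stacks [:: I; hash :: J; V; W; X; Y]).
Proof. by rewrite step6 // /= !cat_take_drop. Qed.

Lemma eval_end b u o J V W X Y :
  step (Eval b u o, stacks [:: [::]; J; V; W; X; Y])
    = (if b && (u == o) then Rewind u else Halt false,
       stacks [:: [::]; J; V; W; X; Y]).
Proof. by rewrite step6 // /= !cat_take_drop. Qed.

(** Each step shortens some nonempty stack. If the values are defined, [X] and [Y] are compared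
    letter by letter; [ohead] also detects different lengths. *)
Lemma rewind_run n u I J V W X Y :
  size J + size W + size X + size Y <= n ->
  exists2 t, t <= n.+1 &
    let c := iter t step (Rewind u, stacks [:: I; J; V; W; X; Y]) in
    if u || (X == Y) then
      c = (if u then Copy else Next,
           stacks [:: catrev J I; [::];
             if u then letter a0 :: catrev W V else catrev W V;
             [::]; [::]; [::]])
    else c.1 = Halt false.
Proof.
elim: n I J V W X Y => [|n IHn] I J V W X Y sn.
  have [/size0nil-> /size0nil-> /size0nil-> /size0nil->] :
    [/\ size J = 0, size W = 0, size X = 0 & size Y = 0] by split; lia.
  exists 1 => //=; rewrite eqxx orbT step6 //=.
  by case: u; rewrite /= !cat_take_drop.
case E : [&& nilp J, nilp W, nilp X & nilp Y].
  move: E => /and4P[/nilP-> /nilP-> /nilP-> /nilP->].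
  have [t tn] := IHn I [::] V [::] [::] [::] isT.
  by exists t; first exact: leqW.
have nilp_take (s : seq G) : nilp (take l.+1 s) = nilp s by case: s.
have ohead_take (s : seq G) : ohead (take l.+1 s) = ohead s by case: s.
have take1_take (s : seq G) : take 1 (take l.+1 s) = take 1 s.
  by case: s => //= a s; rewrite !take0.
have behead_take (s : seq G) : behead (take l.+1 s) ++ drop l.+1 s = behead s.
  by case: s => //= a s; rewrite cat_take_drop.
case hXY : (~~ u && (ohead X != ohead Y)).
  exists 1 => //; rewrite -[iter 1 _ _]/(step _) step6 //=.
  rewrite !nilp_take !ohead_take E hXY /=.
  case/andP: hXY => /negPf -> nXY /=; case: eqP => // XY.
  by rewrite XY eqxx in nXY.
have [|t tn IH] := IHn (take 1 J ++ I) (behead J) (take 1 W ++ V) (behead W)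
    (behead X) (behead Y).
  rewrite !size_behead; move: E.
  by case: (J) sn; case: (W); case: (X); case: (Y) => //= *; lia.
exists t.+1 => //; rewrite iterSr step6 //= !nilp_take !ohead_take E hXY /=.
rewrite !take1_take !behead_take -!catA !cat_take_drop.
have -> : (u || (X == Y)) = (u || (behead X == behead Y)).
  case: (u) hXY => //= /negbFE /eqP.
  by case: (X) (Y) => [|a s] [|b s'] //= [->]; rewrite eqseq_cons eqxx.
have catrev1 (s r : seq G) : catrev (behead s) (take 1 s ++ r) = catrev s r.
  by case: s => //= a s; rewrite take0.
by move: IH; rewrite !catrev1.
Qed.

(** * One visit of a node *)

(** The node visited is [rev V]: its last letter is on top, so moving to a child, sibling or parent
    touches only the top. *)
Definition base (w : seq S) (V : seq A) :=
  stacks [:: rev (map inl w); [::]; map letter V; [::]; [::]; [::]].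

Definition pair_word (x y : seq Delta) : seq S :=
  map Some x ++ None :: map Some y.

Lemma pair_word_inj x y x' y' :
  pair_word x y = pair_word x' y' -> x = x' /\ y = y'.
Proof.
elim: x x' => [|d x IHx] [|d' x'] //= [].
  by move/inj_map => ->// ? ? [].
by move=> -> /IHx[-> ->].
Qed.

Lemma map_inl_pair_word x y :
  map inl (pair_word x y) = map sym x ++ hash :: map sym y.
Proof. by rewrite map_cat /= -!map_comp. Qed.

Lemma rev_pair_word x y : rev (map inl (pair_word x y))
  = map sym (rev y) ++ hash :: map sym (rev x) ++ [::] :> seq G.
Proof.
by rewrite map_inl_pair_word rev_cat rev_cons cat_rcons !map_rev cats0.
Qed.

(** Here [n] is the input length and [m] the depth: [4 * m] pays for copying the node and clearing
    three copies, [2 * n] for crossing the input twice, [2 * B * n] for the letters added by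
    generators. *)
Definition iteration_cost n m := 4 * m + (2 * n + 2 * B * n + 3).

Lemma copy_base w V : iter (size V).+1 step (Copy, base w V)
  = (Eval false false false,
     estacks false (rev (map inl w)) [::] [::] (map letter (rev V))
       (rev V) (rev V)).
Proof.
rewrite -(size_map letter V) /base /estacks copy_run.
by rewrite !catrevE !cats0 !map_rev.
Qed.

Lemma iteration x y V :
  let w := pair_word x y in let v := rev V in
  exists2 t, t <= iteration_cost (size w) (size V) &
    let c := iter t step (Copy, base w V) in
    if word_value x v == word_value y v then
      c = if word_value x v is None then (Copy, base w (a0 :: V))
          else (Next, base w V)
    else c.1 = Halt false.
Proof.
move=> w v.
have [o [Y [yE vY sY]]] := eval_run y false false false
  (hash :: map sym (rev x) ++ [::]) [::] [::] (map letter v) v v.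
have [u [X [xE vX sX]]] := eval_run x true false o [::]
  (hash :: map sym y ++ [::]) [::] (map letter v) v Y.
rewrite !eval_fromE in vX vY; rewrite /estacks /= in xE yE.
(* From right to left: copying, evaluating [y], crossing the separator, evaluating [x], comparing
   the flags. *)
pose t0 := 1 + (size x + (1 + (size y + (size V).+1))).
have t0E : iter t0 step (Copy, base w V) =
    (if u == o then Rewind u else Halt false,
     stacks [:: [::]; map inl w; [::]; map letter v; map letter X;
                map letter Y]).
  have iter1 c : iter 1 step c = step c by [].
  rewrite /t0 !iterD !iter1 copy_base rev_pair_word /estacks yE.
  by rewrite eval_hash xE eval_end map_inl_pair_word cats0.
have sw : size w = size x + (size y).+1 by rewrite size_cat /= !size_map.
have sv : size v = size V by rewrite size_rev.
case uo : (u == o); last first.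
  exists t0; first by rewrite /iteration_cost; lia.
  rewrite t0E uo -vX -vY.
  by case: (u) (o) uo => -[].
have [|t tn tE] := @rewind_run (size w + size V + size X + size Y) u [::]
  (map inl w) [::] (map letter v) (map letter X) (map letter Y).
  by rewrite !size_map sv.
exists (t + t0); first by rewrite /iteration_cost; nia.
rewrite iterD t0E uo; move: tE.
rewrite -vX -vY !catrevE !cats0 -map_rev /v revK.
rewrite -(eqP uo).
case: (u) => //=.
rewrite (inj_eq (@Some_inj _)) (inj_eq (inj_map _)) //.
by move=> ? ? [].
Qed.

Lemma next_step w a V : step (Next, base w (a :: V)) =
  if next_letter a is Some b then (Copy, base w (b :: V)) else (Next, base w V).
Proof.
rewrite /base step6 //=.
by case: (next_letter a) => [b|] /=; rewrite !cat_take_drop.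
Qed.

Lemma next_nil w : (step (Next, base w [::])).1 = Halt true.
Proof. by rewrite /base step6. Qed.

Lemma next_letterE p a r : enum A = p ++ a :: r -> next_letter a = ohead r.
Proof.
move=> Aa; have ap : (a \in p) = false.
  by have := enum_uniq A; rewrite Aa cat_uniq => /and3P[_ /norP[/negPf]].
rewrite /next_letter Aa index_cat ap index_head addn0.
by rewrite -cat_rcons onth_cat size_rcons ltnn subnn; case: r {Aa}.
Qed.

(** * Depth-first search and its cost *)

Section Search.
Variables (x y : seq Delta) (s : seq (seq A)).
Let w := pair_word x y.
(** From this depth on the value of [x] is defined, so the search goes no deeper. *)
Let D := l.+1 * size w.
Let c := iteration_cost (size w) D.
Hypothesis sP : forall v, word_value x v = None -> v \in s.

(** Bound for the whole subtree at [v]. Only undefined words have their children visited, which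
    bounds the number of nodes by the second factor; each node costs [c], plus one [Next] step per
    child. *)
Let visit_cost v := (c + #|A|) * (1 + #|A| * count (prefix v) s).

(** A separate [V'] is needed because the last sibling backtracks to its parent. *)
Definition visit_ok t V V' (P : seq A -> Prop) :=
  ((iter t step (Copy, base w V)).1 = Halt false /\
     exists v, word_value x v <> word_value y v) \/
  (iter t step (Copy, base w V) = (Next, base w V') /\
     forall v, P v -> word_value x v = word_value y v).

(** As [v] itself is counted in [s], its bound exceeds those of its children by enough to pay for
    the visit of [v]. *)
Lemma visit_costE v : v \in s ->
  c + \sum_(a : A) (visit_cost (rcons v a)).+1 <= visit_cost v.
Proof.
move=> vs; have := count_prefix_children v s.
have {vs} : 0 < count_mem v s by rewrite -has_count has_pred1.
rewrite /visit_cost; set N := count (prefix v) s; set k := #|A|.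
set M := \sum_(a : A) count _ _ => N0 MN.
under eq_bigr => a _ do rewrite -addn1.
rewrite big_split /= sum_nat_const muln1 -big_distrr big_split /=.
rewrite sum_nat_const muln1 -big_distrr /= -/k -/M.
apply: (@leq_trans ((c + k) * (1 + k * (1 + M)))).
  by rewrite !mulnDr !muln1 !mulnDl; lia.
rewrite leq_mul2l leq_add2l leq_mul2l.
by apply/orP; right; apply/orP; right; lia.
Qed.

Lemma defined_agree v u : word_value x v = word_value y v ->
  word_value x v -> word_value x (v ++ u) = word_value y (v ++ u).
Proof.
move=> e; case xv: (word_value x v) => [r|] // _.
by rewrite (riAut_cat _ xv) (riAut_cat _ (etrans (esym e) xv)).
Qed.

(** Induction on [e], which exceeds the depth still available below [V]. *)
Lemma visit e V : size V <= D -> D < size V + e ->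
  exists2 t, t <= visit_cost (rev V) & visit_ok t V V (prefix (rev V)).
Proof.
elim: e V => [|e IHe] V VD De; first by lia.
have [t tc] := iteration x y V.
have {}tc : t <= c by apply: leq_trans tc _; rewrite leq_add2r leq_mul2l.
have cT v : c <= visit_cost v.
  by apply: leq_trans (leq_addr #|A| _) _; rewrite /visit_cost leq_pmulr.
case: eqP => [xy|nxy] tE; last first.
  by exists t; [exact: leq_trans tc (cT _) | left; split=> //; exists (rev V)].
case xV: (word_value x (rev V)) tE => [r|] tE.
  exists t; first exact: leq_trans tc (cT _).
  by right; split=> // v /prefixP[u ->]; apply: defined_agree => //; rewrite xV.
have VltD : size V < D.
  rewrite ltnNge; apply/negP => DV.
  suff : word_value x (rev V) by rewrite xV.
  apply: word_value_long lP _ _ _; rewrite size_rev; apply: leq_trans DV.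
  by rewrite leq_mul2l size_cat size_map leq_addr orbT.
(* Inner induction over the siblings: those in [p] are done, [a] is next and [r] remains. *)
have children r p a : enum A = p ++ a :: r ->
    exists2 t', t' <= \sum_(b <- a :: r) (visit_cost (rev (b :: V))).+1 &
    visit_ok t' (a :: V) V
      (fun v => has (fun b => prefix (rev (b :: V)) v) (a :: r)).
  elim: r p a => [|b r IHr] p a Aa; rewrite big_cons;
    (have [//||t1 t1c [[h xy1]|[t1E xy1]]] := IHe (a :: V);
     first by rewrite /= addSnnS).
  1,3: exists t1; last by left.
  1,2: exact: leq_trans t1c (leq_trans (leqnSn _) (leq_addr _ _)).
  - exists t1.+1; first exact: leq_trans (leq_addr _ _).
    right; split=> [|v /=]; last by rewrite orbF; exact: xy1.
    by rewrite iterS t1E next_step (next_letterE Aa).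
  have [|t2 t2c t2E] := IHr (rcons p a) b; first by rewrite cat_rcons.
  exists (t2 + t1.+1); first by rewrite addnC leq_add.
  rewrite /visit_ok iterD iterS t1E next_step (next_letterE Aa) /=.
  case: t2E => [h|[-> xy2]]; first by left.
  by right; split=> // v /orP[/xy1|/xy2].
have [r Ar] : exists r, enum A = [::] ++ a0 :: r.
  by case: (enum A) a0P => // a r [->]; exists r.
have [t' t'c t'E] := children r [::] a0 Ar.
exists (t' + t).
  have := visit_costE (sP xV); rewrite -big_enum Ar.
  apply: leq_trans; rewrite addnC leq_add //; apply: leq_trans t'c _.
  by apply: eq_leq; apply: eq_bigr => b _; rewrite rev_cons.
rewrite /visit_ok iterD tE; case: t'E => [|[-> xy']]; first by left.
(* A word below the node is the node itself, where the values agree by [xy], or lies below one of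
   the children. *)
right; split=> // v /prefixP[[|b u] ->]; first by rewrite cats0.
apply: xy'; rewrite -[a0 :: r]/([::] ++ a0 :: r) -Ar; apply/hasP.
by exists b; rewrite ?mem_enum // rev_cons -cat_rcons prefix_prefix.
Qed.

Lemma search_run : exists2 t, t <= (visit_cost [::]).+1 &
  (iter t step (Copy, base w [::])).1 = Halt `[< word_value x = word_value y >].
Proof.
have [||t tc [[h [v xy]]|[tE xy]]] := @visit D.+1 [::]; rewrite ?add0n //.
  exists t; first exact: leqW.
  by rewrite h; congr Halt; apply/esym/asboolPn => e; apply: xy; rewrite e.
exists t.+1 => //; rewrite iterS tE next_nil; congr Halt; apply/esym/asboolP.
by apply: riAut_eq => v; apply: xy; exact: prefix0s.
Qed.

End Search.

(** * Malformed inputs and total running time *)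

Lemma last_separator (w : seq S) : (exists y, w = map Some y) \/
  exists w' y, w = w' ++ None :: map Some y.
Proof.
elim/last_ind: w => [|w [d|]]; first by left; exists [::].
  case=> [[y ->]|[w' [y ->]]]; [left|right].
    by exists (rcons y d); rewrite map_rcons.
  by exists w', (rcons y d); rewrite map_rcons rcons_cat.
by right; exists w, [::]; rewrite cats1.
Qed.

(** Without a separator the input ends while the second word is being applied; with two or more, the
    second one met halts the run. *)
Lemma reject_run w : (forall x y, w <> pair_word x y) ->
  exists2 t, t <= (size w).+2 &
    (iter t step (Copy, base w [::])).1 = Halt false.
Proof.
move=> nw; have iter1 c : iter 1 step c = step c by [].
have t1E : step (Copy, base w [::]) = (Eval false false false,
    estacks false (rev (map inl w)) [::] [::] [::] [::] [::]).
  exact: (copy_base w [::]).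
have [[y wE]|[w' [y wE]]] := last_separator w.
  have [o [Y [yE _ _]]] :=
    eval_run y false false false [::] [::] [::] [::] [::] [::].
  exists (1 + (size y + 1)); first by rewrite wE size_map; lia.
  rewrite !iterD !iter1 t1E.
  have -> : rev (map inl w) = map sym (rev y) ++ [::] :> seq G.
    by rewrite cats0 wE -map_comp map_rev.
  by rewrite yE /estacks eval_end.
have [o [Y [yE _ _]]] := eval_run y false false false
  (hash :: rev (map inl w')) [::] [::] [::] [::] [::].
have [[x w'E]|[w'' [x w'E]]] := last_separator w'.
  by case: (nw x y); rewrite wE w'E.
have [u [X [xE _ _]]] := eval_run x true false o
  (hash :: rev (map inl w'')) (hash :: map sym y ++ [::]) [::] [::] [::] Y.
exists (1 + (size x + (1 + (size y + 1)))).
  by rewrite wE w'E !size_cat /= !size_map; lia.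
rewrite !iterD !iter1 t1E.
have -> : rev (map inl w)
    = map sym (rev y) ++ hash :: rev (map inl w') :> seq G.
  by rewrite wE map_cat rev_cat /= rev_cons cat_rcons -map_comp map_rev.
have w'r : rev (map inl w')
    = map sym (rev x) ++ hash :: rev (map inl w'') :> seq G.
  by rewrite w'E map_cat rev_cat /= rev_cons cat_rcons -map_comp map_rev.
rewrite yE /estacks eval_hash w'r; rewrite /estacks /= in xE.
by rewrite xE eval_hash.
Qed.

Lemma sm_init_base w : @sm_init S A 5 phase Copy w = (Copy, base w [::]).
Proof. by congr pair; apply/funext => -[[|[|[|[|[|[|]]]]]] lti]. Qed.

Variable C : nat.
Hypothesis CP : forall x : seq Delta, exists2 s, size s <= C * size x &
  forall v, word_value x v = None -> v \in s.

(** The cost of the search from the root, with [C * n] bounding the number of undefined words, plus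
    the final accepting step. *)
Definition decision_cost n :=
  ((iteration_cost n (l.+1 * n) + #|A|) * (1 + #|A| * (C * n))).+1.

Lemma word_problem_run w : exists t, exists2 b,
  t <= decision_cost (size w) /\
    phase_verdict (iter t step (@sm_init S A 5 phase Copy w)).1 = Some b
  & b <-> word_problem Delta w.
Proof.
rewrite sm_init_base.
have [[x [y wE]]|nw] := pselect (exists x y, w = pair_word x y).
  have [s ss sP] := CP x; have [t tc tE] := search_run y sP.
  rewrite wE; exists t, `[< word_value x = word_value y >].
    split; last by rewrite tE.
    apply: leq_trans tc _; rewrite ltnS leq_mul2l leq_add2l leq_mul2l.
    apply/orP; right; apply/orP; right; apply: leq_trans (count_size _ _) _.
    apply: leq_trans ss _.
    by rewrite leq_mul2l size_cat size_map leq_addr orbT.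
  split=> [/asboolP e|[x' [y' [e xy]]]]; first by exists x, y.
  by have [-> ->] := pair_word_inj e; apply/asboolP.
have [|t tc tE] := @reject_run w.
  by move=> x y wE; apply: nw; exists x, y.
exists t, false; last by split=> // -[x [y [wE _]]]; case: nw; exists x, y.
split; last by rewrite tE.
apply: leq_trans tc _; rewrite /decision_cost ltnS.
apply: (@leq_trans ((iteration_cost (size w) (l.+1 * size w) + #|A|) * 1)).
  by rewrite muln1 /iteration_cost; lia.
by rewrite leq_mul2l leq_addr orbT.
Qed.

End Program.

Theorem proposition5p5 (k : nat) (A : finType) (hA : #|A| = k) (hk : 2 <= k)
    (Delta : {fset riAut A}) (hDelta : generating_set Delta) :
  in_P (word_problem Delta).
Proof.
have [a0 a0P] : exists a0, onth (enum A) 0 = Some a0.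
  have : 0 < size (enum A) by rewrite -cardE hA; lia.
  by case: (enum A) => // a s _; exists a.
have [l0 l0P] := generators_long_defined Delta.
(* The successor keeps the window nonempty: every phase must see the top letters. *)
have lP (d : Delta) v : l0.+1 <= size v -> isSome (val d v).
  by move/ltnW; exact: l0P.
have [B BP] := generator_take_size_bound Delta l0.+1.
have [C CP] := undefined_words lP.
(* The number of Turing machine steps per program step. *)
pose e := l0.+1 + (l0.+2 + B) + 2.
exists (sm_tm l0.+1 (l0.+2 + B) Copy phase_verdict (@prog A Delta a0)).
(* This is [iteration_cost] at the maximal depth, as a polynomial in the input length. *)
pose c := ((4 * l0.+1)%N%:P * 'X + (2%N%:P * 'X + (2 * B)%N%:P * 'X + 3%N%:P))%R
  : {poly nat}.
exists ('X + 1%N%:P + (1%N%:P +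
  (c + #|A|%:P) * (1%N%:P + #|A|%:P * (C%:P * 'X))) * e%:P)%R.
move=> w; have [t [b [tc tb] bP]] := word_problem_run a0P lP BP CP w.
exists b => //.
have l0K : l0.+1 <= l0.+2 + B by lia.
have h := sm_tm_answers l0K (prog_size a0 BP) tb.
apply: tm_answers_within_mono h.
rewrite !(hornerD, hornerM, hornerC, hornerX).
suff : (size w).+1 + t * e
    <= size w + 1 + decision_cost A l0 B C (size w) * e.
  by rewrite /decision_cost /iteration_cost -add1n (mulnA 4).
by rewrite addn1 leq_add2l leq_mul2r tc orbT.
Qed.
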